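(* Let $k_1<k_2<\dots<k_m$ be positive integers and let $\gamma_t=\gamma_t^{(k_1,\dots,k_m)}\subset\mathbb{R}^{2m}$, $t\in(-\infty,0)$, be the torus curve solution to the curve shortening flow. Then the tangent flow to $\gamma_t$ at $t=-\infty$ is the multiplicity $k_m$ circle, and the tangent flow to $\gamma_t$ at $t=0$ is the multiplicity $k_1$ circle.
   Context: The curve shortening flow for parametrized immersed curves $\gamma_t(\theta)\in\mathbb{R}^N$ is $\partial_t\gamma_t=\Delta_{\gamma_t}\gamma_t$, where $\Delta_{\gamma_t}=\frac{1}{|\partial_\theta\gamma_t|}\partial_\theta\big(\frac{1}{|\partial_\theta\gamma_t|}\partial_\theta\,\cdot\big)$ is the Laplacian of the induced metric applied to each coordinate. An ancient solution is one defined for all $t\in(-\infty,0)$. Torus curve solution: $\gamma_t^{(k_1,\dots,k_m)}$ is the family of closed curves in $\mathbb{R}^{2m}$ with coordinates $$(\gamma_t(\theta))_{2j-1}=r(t)^{k_j^2}\cos(k_j\theta),\qquad (\gamma_t(\theta))_{2j}=r(t)^{k_j^2}\sin(k_j\theta),\qquad j=1,\dots,m,\ \theta\in[0,2\pi),$$ where $r:(-\infty,0)\to(0,\infty)$ is the unique positive function with $\lim_{t\to-\infty}r(t)=+\infty$ and $\lim_{t\to0}r(t)=0$ for which $\gamma_t$ is a solution to the curve shortening flow. The tangent flow of an ancient solution $M_t$ at $-\infty$ (respectively at $0$) is the limit of the rescaled immersed submanifolds $\frac{M_t}{\sqrt{-t}}$ as $t\to-\infty$ (respectively $t\to0$). The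 multiplicity $k$ circle is a round circle centered at the origin in a 2-plane, traversed $k$ times (counted with the parametrization $\theta\in[0,2\pi)$). *)

(* Defs.v *)
(* MathComp / MathComp-Analysis, over an arbitrary R : realType. *)
From HB Require Import structures.
From mathcomp Require Import all_boot all_order all_algebra.
From mathcomp Require Import all_classical all_reals all_analysis.

Set Implicit Arguments.
Unset Strict Implicit.
Unset Printing Implicit Defensive.

Import Order.TTheory GRing.Theory Num.Theory numFieldNormedType.Exports.
Local Open Scope ring_scope.
Local Open Scope classical_set_scope.

(* The library norm on 'rV[R]_N is the sup norm, so the Euclidean structure is
   introduced separately; both norms induce the same uniform structure. *)
Definition dotv {R : realType} {N : nat} (u v : 'rV[R]_N) : R :=
  (u *m v^T) 0 0.

Definition enorm {R : realType} {N : nat} (v : 'rV[R]_N) : R :=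
  Num.sqrt (dotv v v).

(* A closed curve in R^N is a map R -> 'rV[R]_N of the angle theta; a family of
   curves takes the time first: gamma t theta. *)
Definition immersed_curve {R : realType} {N : nat} (c : R -> 'rV[R]_N) : Prop :=
  (forall (n : nat) (theta : R), derivable c^`(n) theta 1) /\
  (forall theta : R, c^`() theta != 0).

Definition arclength_derive {R : realType} {N : nat}
    (c f : R -> 'rV[R]_N) : R -> 'rV[R]_N :=
  fun theta => (enorm (c^`()%classic theta))^-1 *: f^`()%classic theta.

Definition laplacian {R : realType} {N : nat}
    (c f : R -> 'rV[R]_N) : R -> 'rV[R]_N :=
  arclength_derive c (arclength_derive c f).

(* Only the times t < 0 matter: the values of gamma at t >= 0 are junk. *)
Definition ancient_csf {R : realType} {N : nat}
    (gamma : R -> R -> 'rV[R]_N) : Prop :=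
  forall t : R, t < 0 ->
    immersed_curve (gamma t) /\
    forall theta : R,
      is_derive t 1 (fun s => gamma s theta)
        (laplacian (gamma t) (gamma t) theta).

(* Coordinates are numbered from 0: the indices 2j and 2j+1 carry the cosine
   and the sine belonging to k j, for j : 'I_m.+1. *)
Definition torus_curve {R : realType} {m : nat} (k : 'I_m.+1 -> nat)
    (r : R -> R) : R -> R -> 'rV[R]_(2 * m.+1) :=
  fun t theta => \row_(i < 2 * m.+1)
    let kj := k (inord i./2) in
    r t ^+ (kj ^ 2)%N *
      (if odd i then sin (kj%:R * theta) else cos (kj%:R * theta)).

Definition torus_radius {R : realType} {m : nat} (k : 'I_m.+1 -> nat)
    (r : R -> R) : Prop :=
  [/\ forall t : R, t < 0 -> 0 < r t,
      r t @[t --> -oo] --> +oo,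
      r t @[t --> 0^'-] --> 0
    & ancient_csf (torus_curve k r)].

(* Smooth (C^infinity) convergence, along the filter F on times, of the
   rescaled parametrized curves.  For closed curves, i.e. functions periodic in
   theta, uniformity over R is uniformity over the circle. *)
Definition rescaled_limit {R : realType} {N : nat} (F : set_system R)
    (gamma : R -> R -> 'rV[R]_N) (c : R -> 'rV[R]_N) : Prop :=
  forall n : nat,
    {uniform, (fun t : R =>
                 (fun theta => (Num.sqrt (- t))^-1 *: gamma t theta)^`(n)) @ F
              --> c^`(n)}.

Definition tangent_flow_at_ninfty {R : realType} {N : nat}
    (gamma : R -> R -> 'rV[R]_N) (c : R -> 'rV[R]_N) : Prop :=
  rescaled_limit -oo gamma c.

Definition tangent_flow_at_0 {R : realType} {N : nat}
    (gamma : R -> R -> 'rV[R]_N) (c : R -> 'rV[R]_N) : Prop :=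
  rescaled_limit 0^'- gamma c.

Definition multiplicity_circle {R : realType} {N : nat} (k : nat)
    (c : R -> 'rV[R]_N) : Prop :=
  exists (rho : R) (e1 e2 : 'rV[R]_N),
    [/\ 0 < rho, dotv e1 e1 = 1, dotv e2 e2 = 1, dotv e1 e2 = 0
      & forall theta : R,
          c theta = (rho * cos (k%:R * theta)) *: e1
                  + (rho * sin (k%:R * theta)) *: e2].

(* Main.v *)
(* Differentiating the sum of the squared radii r^(2 k_j^2) of the coordinate
   circles along the flow gives the constant -2, so this sum equals -2t. As
   t -> -oo (resp. t -> 0) one has r -> +oo (resp. r -> 0), and the term of
   largest (resp. smallest) frequency dominates the others; after rescaling by
   1/sqrt(-t) only its circle survives, with radius sqrt 2. Derivatives in
   theta only multiply each coordinate by a power of its frequency and shift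
   its phase, so the convergence holds in every C^n norm. *)
Require Import Defs.
From HB Require Import structures.
From mathcomp Require Import all_boot all_order all_algebra.
From mathcomp Require Import all_classical all_reals all_analysis.
From mathcomp Require Import ring.

Import Order.TTheory GRing.Theory Num.Theory numFieldNormedType.Exports.
Local Open Scope ring_scope.
Local Open Scope classical_set_scope.

(** * Curves whose coordinates are cosines: derivatives and uniform limits *)

(** A free phase in each coordinate covers sines as well and makes the family stable under
    differentiation and scaling, with frequencies unchanged. *)
Definition harmonic {R : realType} {N : nat} (a w p : 'I_N -> R) :
    R -> 'rV[R]_N :=
  fun theta => \row_i (a i * cos (w i * theta + p i)).

Lemma is_derive_harmonic_coord (R : realType) (a w p x : R) :
  is_derive x 1 (fun y => a * cos (w * y + p))
    (a * w * cos (w * x + (p + pi / 2))).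
Proof.
have lin : is_derive x 1 (fun y : R => w * y + p) w.
  apply: (@is_derive_eq _ _ _ ((w \*: id) + cst p)).
  by rewrite addr0 /GRing.scale /= mulr1.
have H := @is_derive1_comp _ cos _ x _ _ (is_derive_cos (w * x + p)) lin.
apply: (@is_derive_eq _ _ _ (a \*: (cos \o (fun y : R => w * y + p)))).
by rewrite addrA cosDpihalf /GRing.scale /=; ring.
Qed.

Lemma derive1_harmonic (R : realType) (N : nat) (a w p : 'I_N -> R) :
  (harmonic a w p)^`() =
  harmonic (fun i => a i * w i) w (fun i => p i + pi / 2).
Proof.
apply/funext => x.
have coord i j : is_derive x 1 (fun y => harmonic a w p y i j)
    (a j * w j * cos (w j * x + (p j + pi / 2))).
  have -> : (fun y => harmonic a w p y i j) =
            (fun y => a j * cos (w j * y + p j)).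
    by apply/funext => y; rewrite mxE.
  exact: is_derive_harmonic_coord.
rewrite derive1E derive_mx; last first.
  by apply/derivable_mxP => i j; apply: ex_derive; exact: coord.
by apply/rowP => i; rewrite !mxE; have H := coord 0 i; rewrite derive_val.
Qed.

Lemma derive1n_harmonic (R : realType) (N n : nat) (a w p : 'I_N -> R) :
  (harmonic a w p)^`(n) =
  harmonic (fun i => a i * w i ^+ n) w (fun i => p i + (pi / 2) *+ n).
Proof.
elim: n => [|n IHn].
  rewrite derive1n0; apply/funext => x; apply/rowP => i.
  by rewrite !mxE expr0 mulr1 mulr0n addr0.
rewrite derive1nS IHn derive1_harmonic.
apply/funext => x; apply/rowP => i; rewrite !mxE.
by rewrite -[a i * _ * _]mulrA -exprSr -[p i + _ + _]addrA -mulrSr.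
Qed.

Lemma scale_harmonic (R : realType) (N : nat) (s : R) (a w p : 'I_N -> R) :
  (fun theta => s *: harmonic a w p theta) = harmonic (fun i => s * a i) w p.
Proof. by apply/funext => x; apply/rowP => i; rewrite !mxE mulrA. Qed.

(** Frequencies and phases do not depend on [t], so two [n]-th derivatives differ in coordinate [i]
    by [(b i - a t i) * w i ^+ n] times a cosine. The cosine is at most 1 in absolute value, which
    makes the bound independent of the angle. *)
Lemma cvg_uniform_harmonic (R : realType) (N : nat) (F : set_system R)
    {FF : Filter F} (a : R -> 'I_N -> R) (b w p : 'I_N -> R) (n : nat) :
  (forall i, a t i @[t --> F] --> b i) ->
  {uniform, (fun t => (harmonic (a t) w p)^`(n)) @ F
            --> (harmonic b w p)^`(n)}.
Proof.
move=> ab A /uniform_nbhs [E [entE EA]].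
move: entE; rewrite -entourage_ballE => -[e /= e0 eE].
rewrite /nbhs /=; near=> t; apply: EA => x _; apply: eE => /=.
rewrite !derive1n_harmonic; split => // i j; rewrite !mxE.
rewrite -ball_normE /= -mulrBl -mulrBl -mulrA normrM.
have le1 : `|cos (w j * x + (p j + (pi / 2) *+ n))| <= 1.
  by rewrite ler_norml cos_geN1 cos_le1.
(* There are finitely many coordinates, so a single member of [F] serves them all. *)
have close : forall i : 'I_N, `|b i - a t i| * `|w i ^+ n| < e.
  near: t; apply: filter_forall => k.
  have c : (b k - a t k) * w k ^+ n @[t --> F] --> (0 : R).
    rewrite -[X in _ --> X](mul0r (w k ^+ n)) -(subrr (b k)).
    by apply: cvgM; [apply: cvgB => //; exact: cvg_cst|exact: cvg_cst].
  move/cvgr0_norm_lt: c => /(_ _ e0); apply: filterS => t.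
  by rewrite normrM.
apply: le_lt_trans (close j).
by rewrite normrM ler_wpM2l// ler_piMr.
Unshelve. all: by end_near. Qed.

(** * Speed and Laplacian of the torus curve *)

Lemma sum_ord_pairs (V : nmodType) (n : nat) (f : nat -> V) :
  \sum_(i < 2 * n) f i = \sum_(j < n) (f j.*2 + f j.*2.+1).
Proof.
elim: n => [|n IHn]; first by rewrite muln0 !big_ord0.
by rewrite mulnS addnC addn2 !big_ord_recr /= IHn -addrA mul2n.
Qed.

Lemma dotvE (R : realType) (N : nat) (u v : 'rV[R]_N) :
  dotv u v = \sum_i u 0 i * v 0 i.
Proof. by rewrite /dotv mxE; apply: eq_bigr => i _; rewrite mxE. Qed.

(** Since [i < 2 * m.+1], the half of [i] is in range and [inord] never takes its default value. *)
Definition paired {R : realType} {m : nat} (A : 'I_m.+1 -> R) :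
    'I_(2 * m.+1) -> R :=
  fun i => A (inord i./2).

Definition freq {R : realType} {m : nat} (k : 'I_m.+1 -> nat) :
    'I_(2 * m.+1) -> R :=
  paired (fun j => (k j)%:R).

(* A sine is a cosine with phase - pi / 2. *)
Definition phase {R : realType} {m : nat} : 'I_(2 * m.+1) -> R :=
  fun i => if odd i then - (pi / 2) else 0.

Lemma torus_curveE (R : realType) (m : nat) (k : 'I_m.+1 -> nat)
    (r : R -> R) (t : R) :
  torus_curve k r t =
  harmonic (paired (fun j => r t ^+ (k j ^ 2)%N)) (freq k) phase.
Proof.
apply/funext => x; apply/rowP => i; rewrite !mxE /paired /freq /phase /paired.
by case: ifP => _; rewrite ?addr0 // cosBpihalf.
Qed.

(** In each pair the two squares add up to [A j ^+ 2], whatever the common shift [q]. With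
    [q = pi / 2] this shows that the torus curve has constant speed. *)
Lemma enorm_paired (R : realType) (m : nat) (k : 'I_m.+1 -> nat)
    (A : 'I_m.+1 -> R) (q x : R) :
  enorm (harmonic (paired A) (freq k) (fun i => phase i + q) x) =
  Num.sqrt (\sum_j A j ^+ 2).
Proof.
rewrite /enorm dotvE; congr Num.sqrt.
pose f (i : nat) := (A (inord i./2) * cos ((k (inord i./2))%:R * x +
  ((if odd i then - (pi / 2) else 0) + q))) ^+ 2.
rewrite (eq_bigr (fun i : 'I_(2 * m.+1) => f i)); last first.
  by move=> i _; rewrite !mxE -expr2.
rewrite sum_ord_pairs; apply: eq_bigr => j _.
rewrite /f /= odd_double /= uphalf_double doubleK inord_val add0r.
rewrite (addrC (- _)) addrA cosBpihalf !exprMn -mulrDr.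
by rewrite cos2Dsin2 mulr1.
Qed.

(** As the speed is constant, the Laplacian is the second angular derivative over the squared speed.
    At angle 0 the cosine coordinate is the radius itself, so this entry yields the evolution
    equation of that radius. *)
Lemma laplacian_torus_curve (R : realType) (m : nat) (k : 'I_m.+1 -> nat)
    (r : R -> R) (t : R) (j : 'I_m.+1) (i : 'I_(2 * m.+1)) :
  i = j.*2 :> nat ->
  laplacian (torus_curve k r t) (torus_curve k r t) 0 0 i =
  - (r t ^+ (k j ^ 2)%N * (k j)%:R ^+ 2) /
    \sum_l (r t ^+ (k l ^ 2)%N * (k l)%:R) ^+ 2.
Proof.
move=> ij; set A := fun l => r t ^+ (k l ^ 2)%N.
pose L : R := \sum_l (A l * (k l)%:R) ^+ 2.
have L0 : 0 <= L by apply: sumr_ge0 => l _; exact: sqr_ge0.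
have speed x : enorm ((torus_curve k r t)^`()%classic x) = Num.sqrt L.
  rewrite torus_curveE derive1_harmonic.
  exact: (enorm_paired _ _ k (fun l => A l * (k l)%:R)).
have arcE f x : arclength_derive (torus_curve k r t) f x =
    (Num.sqrt L)^-1 *: f^`()%classic x.
  by rewrite /arclength_derive speed.
rewrite /laplacian arcE (funext (arcE _)).
rewrite torus_curveE derive1_harmonic scale_harmonic derive1_harmonic !mxE.
rewrite /phase /freq /paired ij odd_double doubleK inord_val mulr0 !add0r.
(* Two derivatives have shifted the phase to [pi / 2 + pi / 2 = pi], whence the minus sign. *)
rewrite -splitr cospi -/L -/(A j) !mulrN1 mulrN.
(* This also covers [L = 0], where both sides are 0. *)
have -> : L^-1 = (Num.sqrt L)^-1 * (Num.sqrt L)^-1.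
  by rewrite -invfM -expr2 sqr_sqrtr.
by rewrite mulNr; congr (- _); ring.
Qed.

(** * The sum of the squared radii along the flow *)

Lemma cvg_sum (R : realType) (T : Type) (F : set_system T) {FF : Filter F}
    (n : nat) (f : 'I_n -> T -> R) (l : 'I_n -> R) :
  (forall i, f i x @[x --> F] --> l i) ->
  \sum_i f i x @[x --> F] --> \sum_i l i.
Proof.
by move=> fl; apply: cvg_big => //; exact: add_continuous.
Qed.

Lemma cvg_expr_to0 (R : realType) (F : set_system R) {FF : Filter F}
    (f : R -> R) (n : nat) :
  (0 < n)%N -> f t @[t --> F] --> (0 : R) ->
  f t ^+ n @[t --> F] --> (0 : R).
Proof.
move=> n0 f0; have := continuous_cvg _ (@exprn_continuous R n 0) f0.
by rewrite expr0n eqn0Ngt n0; apply.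
Qed.

(* The flow gives d/dt r^(k_j^2) = - k_j^2 r^(k_j^2) / L with the squared
   speed L = sum_j k_j^2 r^(2 k_j^2), so the sum below has derivative -2. *)
Lemma torus_radius_sum_sqr (R : realType) (m : nat) (k : 'I_m.+1 -> nat)
    (k_pos : forall j, (0 < k j)%N) (r : R -> R) :
  torus_radius k r -> forall t, t < 0 ->
  \sum_j (r t ^+ (k j ^ 2)%N) ^+ 2 = - t *+ 2.
Proof.
move=> [r_pos _ r0 csf].
pose S (t : R) := \sum_j (r t ^+ (k j ^ 2)%N) ^+ 2.
pose f t := S t + t *+ 2.
have dA (t : R) j : t < 0 -> is_derive t 1 (fun s => r s ^+ (k j ^ 2)%N)
    (- (r t ^+ (k j ^ 2)%N * (k j)%:R ^+ 2) /
      \sum_l (r t ^+ (k l ^ 2)%N * (k l)%:R) ^+ 2).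
  move=> t0; have [_ /(_ 0)[dg dgE]] := csf t t0.
  have i_lt : (j.*2 < 2 * m.+1)%N by rewrite mul2n ltn_double.
  pose i := Ordinal i_lt.
  have coordE : (fun s => torus_curve k r s 0 0 i) =
                (fun s => r s ^+ (k j ^ 2)%N).
    apply/funext => s.
    by rewrite mxE /= odd_double doubleK inord_val mulr0 cos0 mulr1.
  apply: DeriveDef.
    by rewrite -coordE; exact: (derivable_mxP _ _ _).1 dg 0 i.
  by rewrite -(laplacian_torus_curve _ _ k r t j i erefl) -dgE derive_mx// mxE -coordE.
have df (t : R) : t < 0 -> is_derive t 1 f 0.
  move=> t0.
  (* The first summand alone is positive, so the squared speed can be cancelled below. *)
  have L0 : \sum_l (r t ^+ (k l ^ 2)%N * (k l)%:R) ^+ 2 != 0.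
    rewrite gt_eqF// big_ord_recl ltr_wpDr//.
      by apply: sumr_ge0 => l _; exact: sqr_ge0.
    by rewrite exprn_gt0// mulr_gt0 ?ltr0n// exprn_gt0// r_pos.
  have dS := is_derive_sum (fun j => is_deriveX 2 (dA t j t0)).
  have fE : f = (\sum_j (fun s => r s ^+ (k j ^ 2)%N) ^+ 2) + 2 \*: id.
    by apply/funext => s; rewrite fct_sumE /f /S -[s *+ 2]mulr_natl.
  rewrite fE; apply: is_derive_eq.
  rewrite /GRing.scale /= mulr1.
  under eq_bigr do rewrite expr1.
  rewrite (eq_bigr (fun j => - (2 / \sum_l (r t ^+ (k l ^ 2)%N * (k l)%:R) ^+ 2)
      * (r t ^+ (k j ^ 2)%N * (k j)%:R) ^+ 2)); last first.
    by move=> j _; rewrite exprMn; ring.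
  by rewrite -mulr_sumr mulNr divfK// addNr.
have f_cst (s t : R) : s <= t -> t < 0 -> f t = f s.
  move=> st t0.
  have df' x : x \in `[s, t]%R -> is_derive x 1 f 0.
    by rewrite in_itv => /= /andP[_ xt]; apply: df; exact: le_lt_trans t0.
  have dfo (x : R) : x \in `]s, t[%R -> is_derive x 1 f (cst 0 x).
    by move=> xst; apply: df'; move: xst; rewrite !in_itv /= => /andP[/ltW -> /ltW].
  have cf : {within `[s, t], continuous f}.
    by apply: derivable_within_continuous => x /df' H; exact: ex_derive.
  have [c _] := MVT_segment st dfo cf.
  by rewrite mul0r => /eqP; rewrite subr_eq0 => /eqP.
(* Every exponent [k j ^ 2 * 2] is positive, so each term vanishes with [r]; this fixes the constant
   of integration. *)
have S0 : S t @[t --> 0^'-] --> \sum_(j < m.+1) (0 : R).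
  apply: cvg_sum => j; under eq_fun do rewrite -exprM.
  have := continuous_cvg _ (@exprn_continuous R (k j ^ 2 * 2)%N 0) r0.
  by rewrite expr0n muln_eq0 expn_eq0 /= orbF eqn0Ngt k_pos; apply.
have f0 : f t @[t --> 0^'-] --> (0 : R).
  have id0 : (t : R) @[t --> 0^'-] --> (0 : R).
    by apply: cvg_at_left_filter; exact: cvg_id.
  by have := cvgD S0 (cvgD id0 id0); rewrite big1// !addr0; exact.
move=> t t0.
(* On [[t, 0[] the function [f] keeps the value [f t], which must therefore be its left limit at
   0. *)
have /eqP : f t = 0.
  apply: (@cvg_unique _ (@norm_hausdorff _ R^o) (f @ 0^'-)) => //.
  apply: cvg_near_cst; near=> s; apply: f_cst; last first.
    by near: s; exact: nbhs_left_lt.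
  by near: s; apply: nbhs_left_ge.
by rewrite addr_eq0 -mulNrn => /eqP.
Unshelve. all: by end_near. Qed.

(** * Limits of the rescaled radii and the limit circle *)

(** Dividing the sum by [A J t ^+ 2] gives a quantity [Q t] tending to 1. The sum being [-2t], the
    rescaled amplitude of index [j] equals [(A j t / A J t) * Num.sqrt (2 / Q t)]. *)
Lemma cvg_dominant_rescaled (R : realType) (F : set_system R) {FF : Filter F}
    (n : nat) (A : 'I_n -> R -> R) (J : 'I_n) :
  (\forall t \near F, t < 0) ->
  (\forall t \near F, 0 < A J t) ->
  (\forall t \near F, \sum_j A j t ^+ 2 = - t *+ 2) ->
  (forall j, j != J -> A j t / A J t @[t --> F] --> (0 : R)) ->
  forall j, (Num.sqrt (- t))^-1 * A j t @[t --> F] -->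
            (if j == J then Num.sqrt 2 else 0 : R).
Proof.
move=> F_lt0 AJ_gt0 sumA ratio j.
have q_cvg i : A i t / A J t @[t --> F] --> ((i == J)%:R : R).
  have [->|iJ] := eqVneq i J; last exact: ratio.
  by apply: cvg_near_cst; near=> t; rewrite divff// gt_eqF//; near: t.
pose Q t := \sum_i (A i t / A J t) ^+ 2.
have Q_cvg : Q t @[t --> F] --> (1 : R).
  have sum1 : \sum_(i < n) ((i == J)%:R ^+ 2 : R) = 1.
    rewrite (bigD1 J)//= eqxx expr1n big1 ?addr0// => i /negPf ->.
    by rewrite expr0n.
  rewrite -sum1; apply: cvg_sum => i.
  exact: (continuous_cvg _ (@exprn_continuous R 2 _) (q_cvg i)).
have two_div_Q : 2 / Q t @[t --> F] --> (2 / 1 : R).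
  by apply: cvgM; [exact: cvg_cst|apply: cvgV => //; exact: oner_neq0].
have sqrt_cvg := continuous_cvg _ (@sqrt_continuous R _) two_div_Q.
have lim := cvgM (q_cvg j) (sqrt_cvg FF).
have -> : (if j == J then Num.sqrt 2 else 0 : R) =
          (j == J)%:R * Num.sqrt (2 / 1).
  by rewrite divr1; case: eqP; rewrite ?mul1r ?mul0r.
apply: cvg_trans (lim FF); apply: near_eq_cvg; near=> t => /=.
have t0 : 0 < - t by rewrite oppr_gt0; near: t.
have a0 : 0 < A J t by near: t.
have QE : Q t = (- t *+ 2) / A J t ^+ 2.
  rewrite -(_ : \sum_j A j t ^+ 2 = - t *+ 2); last by near: t.
  by rewrite /Q mulr_suml; apply: eq_bigr => i _; rewrite expr_div_n.
have -> : 2 / Q t = A J t ^+ 2 / - t.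
  rewrite QE -mulr_natr; field.
  by rewrite (gt_eqF a0) -oppr_eq0 (gt_eqF t0).
rewrite sqrtrM ?sqr_ge0// sqrtr_sqr gtr0_norm// sqrtrV ?ltW//.
by rewrite mulrA divfK ?gt_eqF// mulrC.
Unshelve. all: by end_near. Qed.

Lemma multiplicity_circle_paired (R : realType) (m : nat)
    (k : 'I_m.+1 -> nat) (J : 'I_m.+1) (rho : R) :
  0 < rho ->
  multiplicity_circle (k J)
    (harmonic (paired (fun j => if j == J then rho else 0)) (freq k) phase).
Proof.
move=> rho0.
have lt0 : (J.*2 < 2 * m.+1)%N by rewrite mul2n ltn_double.
have lt1 : (J.*2.+1 < 2 * m.+1)%N by rewrite mul2n ltn_Sdouble.
pose e l : 'rV[R]_(2 * m.+1) := delta_mx 0 l.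
have dot_e i l : dotv (e i) (e l) = (i == l)%:R.
  rewrite dotvE (bigD1 i)//= big1 ?addr0 => [|q /negPf qi].
    by rewrite !mxE !eqxx mul1r.
  by rewrite !mxE qi andbF mul0r.
(* The plane of the circle is spanned by the cosine and sine axes of the pair [J]. *)
exists rho, (e (Ordinal lt0)), (e (Ordinal lt1)); split => //.
- by rewrite dot_e eqxx.
- by rewrite dot_e eqxx.
- by rewrite dot_e; case: eqP => // /(congr1 val) /= /n_Sn.
move=> x; apply/rowP => i; rewrite !mxE eqxx /= /paired /freq /phase /paired.
have i2 : (i./2 < m.+1)%N by rewrite ltn_half_double -mul2n.
have jJ : (inord i./2 == J) = (i./2 == J :> nat) by rewrite -val_eqE /= inordK.
have e0 : (i == Ordinal lt0) = ~~ odd i && (i./2 == J :> nat).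
  rewrite -val_eqE /= -{1}(odd_double_half i); case: (odd i) => /=.
    by apply/eqP => /(congr1 odd); rewrite add1n /= !odd_double.
  by rewrite add0n; apply/eqP/eqP => [/double_inj|->].
have e1 : (i == Ordinal lt1) = odd i && (i./2 == J :> nat).
  rewrite -val_eqE /= -{1}(odd_double_half i); case: (odd i) => /=.
    by rewrite add1n eqSS; apply/eqP/eqP => [/double_inj|->].
  by apply/eqP => /(congr1 odd); rewrite add0n /= !odd_double.
rewrite e0 e1 jJ; have [iJ|] := eqVneq (i./2) J; last first.
  by move=> _; rewrite !andbF !mulr0 addr0 mul0r.
have -> : inord i./2 = J by apply/eqP; rewrite jJ iJ.
rewrite !andbT; case: (odd i) => /=.
  by rewrite mulr0 mulr1 add0r cosBpihalf.
by rewrite mulr0 mulr1 !addr0.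
Qed.

(** Both ends of time are treated at once: [F] is the end, and the ratio hypothesis says that the
    radius of index [J] dominates there. *)
Lemma rescaled_limit_torus_curve (R : realType) (F : set_system R)
    {FF : Filter F} (m : nat) (k : 'I_m.+1 -> nat)
    (k_pos : forall j, (0 < k j)%N) (r : R -> R) (J : 'I_m.+1) :
  torus_radius k r ->
  (\forall t \near F, t < 0) ->
  (forall j, j != J ->
     r t ^+ (k j ^ 2)%N / r t ^+ (k J ^ 2)%N @[t --> F] --> (0 : R)) ->
  exists c, rescaled_limit F (torus_curve k r) c /\
            multiplicity_circle (k J) c.
Proof.
move=> rr F_lt0 ratio; have [r_pos _ _ _] := rr.
have lim := cvg_dominant_rescaled _ _ _ (fun j t => r t ^+ (k j ^ 2)%N) J F_lt0.
exists (harmonic (paired (fun j => if j == J then Num.sqrt 2 else 0))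
         (freq k) phase).
split; last by apply: multiplicity_circle_paired; rewrite sqrtr_gt0.
move=> n.
have -> : (fun t => (fun theta => (Num.sqrt (- t))^-1 *:
              torus_curve k r t theta)^`(n)) =
    (fun t => (harmonic (paired (fun j => (Num.sqrt (- t))^-1 *
                                  r t ^+ (k j ^ 2)%N)) (freq k) phase)^`(n)).
  by apply/funext => t; rewrite torus_curveE scale_harmonic.
apply: cvg_uniform_harmonic => i; apply: lim => //.
- by apply: filterS F_lt0 => t t0; rewrite exprn_gt0// r_pos.
- by apply: filterS F_lt0 => t; exact: torus_radius_sum_sqr.
Qed.

Theorem proposition2p2 (R : realType) (m : nat) (k : 'I_m.+1 -> nat)
    (k_pos : forall j : 'I_m.+1, (0 < k j)%N)
    (k_incr : forall i j : 'I_m.+1, (i < j)%N -> (k i < k j)%N)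
    (r : R -> R) (r_radius : torus_radius k r) :
  (exists c : R -> 'rV[R]_(2 * m.+1),
      tangent_flow_at_ninfty (torus_curve k r) c /\
      multiplicity_circle (k ord_max) c) /\
  (exists c : R -> 'rV[R]_(2 * m.+1),
      tangent_flow_at_0 (torus_curve k r) c /\
      multiplicity_circle (k ord0) c).
Proof.
have [r_pos r_ninfty r_0 _] := r_radius.
split.
  apply: rescaled_limit_torus_curve => // [|j jmax].
    exact: nbhs_ninfty_lt.
  have kj : (k j < k ord_max)%N.
    by apply: k_incr; rewrite ltn_neqAle jmax -ltnS ltn_ord.
  have k2 : (k j ^ 2 < k ord_max ^ 2)%N by rewrite ltn_exp2r.
  have rV : (r t)^-1 @[t --> -oo] --> (0 : R).
    apply/gtr0_cvgV0 => //.
    by near=> t; apply: r_pos; near: t; exact: nbhs_ninfty_lt.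
  have H : (0 < k ord_max ^ 2 - k j ^ 2)%N by rewrite subn_gt0.
  (* The ratio is a positive power of [(r t)^-1], of exponent [k ord_max ^ 2 - k j ^ 2]. *)
  apply: cvg_trans (cvg_expr_to0 _ _ _ _ H rV).
  apply: near_eq_cvg; near=> t.
  have t0 : 0 < r t by apply: r_pos; near: t; exact: nbhs_ninfty_lt.
  by rewrite exprVn expfB// invf_div.
apply: rescaled_limit_torus_curve => // [|j j0].
  exact: nbhs_left_lt.
have kj : (k ord0 < k j)%N by apply: k_incr; rewrite lt0n.
have k2 : (k ord0 ^ 2 < k j ^ 2)%N by rewrite ltn_exp2r.
have H : (0 < k j ^ 2 - k ord0 ^ 2)%N by rewrite subn_gt0.
(* Here the ratio is a positive power of [r t] itself, of exponent [k j ^ 2 - k ord0 ^ 2]. *)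
apply: cvg_trans (cvg_expr_to0 _ _ _ _ H r_0).
apply: near_eq_cvg; near=> t.
have t0 : 0 < r t by apply: r_pos; near: t; exact: nbhs_left_lt.
by rewrite expfB.
Unshelve. all: by end_near. Qed.
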